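(* Let $N\ge 0$, $a\notin C_0(\Sigma)$, and for $n\ge 1$ put $\widehat p_n^{N}(a;x)=k_n\,p_n^{N}(a;x)$ with $k_n=1+NB_n$, where $$B_n=\frac{-p_n(a)}{\langle x-a,\,p_{n-1}^{**}(a;x)\rangle_\mu}=K_{n-1}(a,a)>0 .$$ Then for every $n\ge 1$ the polynomial $\widehat p_n^{N}$ can be represented as $$\widehat p_n^{N}(a;x)=p_n(x)+N B_n\,(x-a)\,p_{n-1}^{**}(a;x).$$ (The equality of the two expressions for $B_n$ and its positivity are part of the assertion.)
   Context: $\mu$ is a positive Borel measure on $\mathbb R$ whose support $\Sigma$ has infinitely many points, with all moments finite: $\int_\Sigma |x|^n\,d\mu(x)<\infty$ for all integers $n\ge 0$. $C_0(\Sigma)$ is the convex hull of $\Sigma$. $\langle p,q\rangle_\mu=\int_\Sigma pq\,d\mu$ and $\|p\|_\mu^2=\langle p,p\rangle_\mu$. $\{p_n(x)\}_{n\ge0}$ is the sequence of monic orthogonal polynomials for $\mu$ ($\deg p_n=n$). $K_n(x,y)=\sum_{j=0}^n p_j(x)p_j(y)/\|p_j\|_\mu^2$. $\{p_n^{**}(a;x)\}_{n\ge0}$ is the sequence of monic orthogonal polynomials for the measure $(x-a)^2d\mu(x)$. $\{p_n^{N}(a;x)\}_{n\ge0}$ is the sequence of monic orthogonal polynomials for $d\mu_N=d\mu+N\delta_a$, where $\delta_a$ is the unit point mass at $a$. *)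

(* Defs.v *)
From HB Require Import structures.
From mathcomp Require Export all_boot all_order all_algebra.
From mathcomp Require Export all_classical all_reals all_analysis.
From mathcomp Require Export measurable_realfun.

Set Implicit Arguments.
Unset Strict Implicit.
Unset Printing Implicit Defensive.

Import Order.TTheory GRing.Theory Num.Theory.
Import numFieldNormedType.Exports.

Local Open Scope classical_set_scope.
Local Open Scope ring_scope.

Definition msupport (R : realType)
    (mu : {measure set (measurableTypeR R) -> \bar R}) : set R :=
  [set x | forall U : set R, open U -> U x -> (0 < mu U)%E].

(* convex_set is stated for left modules, hence R^o. *)
Definition convex_hull (R : realType) (A : set R) : set R :=
  smallest (@convex_set R R^o) A.

Definition finite_moments (R : realType)
    (mu : {measure set (measurableTypeR R) -> \bar R}) : Prop :=
  forall n : nat, (\int[mu]_(x in msupport mu) (`|x| ^+ n)%:E < +oo)%E.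

(* Each inner product is taken over the support of its own measure, so a
   point mass outside the support of mu is counted in inner (add_mass mu N a).
   Rintegral is 0 on divergent integrals; under finite_moments mu the integrals
   of polynomials against mu, sqr_weight mu a and add_mass mu N a converge. *)
Definition inner (R : realType)
    (mu : {measure set (measurableTypeR R) -> \bar R}) (p q : {poly R}) : R :=
  Rintegral mu (msupport mu) (fun x => p.[x] * q.[x]).

Definition monic_orthogonal (R : realType)
    (mu : {measure set (measurableTypeR R) -> \bar R})
    (p : nat -> {poly R}) : Prop :=
  [/\ forall n, p n \is monic,
      forall n, size (p n) = n.+1
    & forall m n, m <> n -> inner mu (p m) (p n) = 0].

Definition kernel_poly (R : realType)
    (mu : {measure set (measurableTypeR R) -> \bar R})
    (p : nat -> {poly R}) (n : nat) (x y : R) : R :=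
  \sum_(0 <= j < n.+1) (p j).[x] * (p j).[y] / inner mu (p j) (p j).

Definition sqr_weight (R : realType)
    (mu : {measure set (measurableTypeR R) -> \bar R}) (a : R)
    (A : set (measurableTypeR R)) : \bar R :=
  (\int[mu]_(x in A) ((x - a) ^+ 2)%:E)%E.

Section sqr_weight_measure.
Variables (R : realType) (mu : {measure set (measurableTypeR R) -> \bar R}).
Variable a : R.

Let sqr_weight0 : sqr_weight mu a set0 = 0%E.
Proof. by rewrite /sqr_weight integral_set0. Qed.

Let sqr_weight_ge0 A : (0 <= sqr_weight mu a A)%E.
Proof. by apply: integral_ge0 => x _; rewrite lee_fin sqr_ge0. Qed.

Let sqr_weight_sigma_additive : semi_sigma_additive (sqr_weight mu a).
Proof.
move=> /= F mF tF mUF; rewrite /sqr_weight; apply: cvg_toP.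
  apply: ereal_nondecreasing_is_cvgn => m n mn.
  apply: lee_sum_nneg_natr => // k _ _; apply: integral_ge0 => /= x Fkx.
  by rewrite lee_fin sqr_ge0.
rewrite ge0_integral_bigcup//=.
- by apply/measurable_EFinP; apply: measurable_funX; apply: measurable_funB.
- by move=> x _; rewrite lee_fin sqr_ge0.
Qed.

HB.instance Definition _ := isMeasure.Build _ _ _
  (sqr_weight mu a) sqr_weight0 sqr_weight_ge0 sqr_weight_sigma_additive.

End sqr_weight_measure.

Definition add_mass (R : realType)
    (mu : {measure set (measurableTypeR R) -> \bar R}) (N : {nonneg R}) (a : R)
    : {measure set (measurableTypeR R) -> \bar R} :=
  measure_add mu (mscale N (@dirac _ (measurableTypeR R) a R)).

(* Main.v *)
Require Import Defs.
From HB Require Import structures.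
From mathcomp Require Import ring lra.

Import Order.TTheory GRing.Theory Num.Theory.
Import numFieldNormedType.Exports.
Local Open Scope classical_set_scope.
Local Open Scope ring_scope.

Set Implicit Arguments.
Unset Strict Implicit.
Unset Printing Implicit Defensive.

(** Write L g for the integral of a polynomial g over the support of mu, and
    q = (X - a) pss_(n-1), which is monic of degree n and vanishes at a.

    All three orthogonality conditions can be read off L: they concern the
    functionals L, g |-> L ((X - a)^2 g) and g |-> L g + N g(a).  The rest is
    algebra, and it starts from one fact: as pss_(n-1) is orthogonal to lower
    degrees for the second functional, q is orthogonal to (X - a) s whenever
    s has degree less than n - 1.  Splitting r as r(a) + (X - a) s gives
    L (q r) = L q * r(a) for r of degree less than n: up to the constant L q,
    testing against q is evaluation at a ([quasi_reproducing]).  Two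
    consequences follow.

    - The expansion of q - p_n in p_0, ..., p_(n-1) has the coefficients of
      L q * K_(n-1)(x, a) ([quasi_sub_orthogonal]).  At x = a it reads
      - p_n(a) = L q * K_(n-1)(a, a).  Since p_n(a) <> 0, L q is nonzero and
      B_n = K_(n-1)(a, a), a sum of squares over positive norms
      whose first term is positive.
    - Against r of degree less than n, the functional with the point mass
      takes on (p_n + N B q) r the value
      N B L q r(a) + N p_n(a) r(a) = 0, by the choice of B.  So p_n + N B q and
      (1 + N B) pN_n have the same leading coefficient and the same
      orthogonality; their difference is orthogonal to itself, hence zero
      ([uvarov_representation]).

    Both p_n(a) <> 0 and the positivity of L come from the measure.  The
    complement of the support is null, so L h > 0 for a nonzero h that is
    nonnegative on the support, which is infinite ([moment_functional_gt0]).
    Outside the convex hull, X - a has a constant sign on the support; if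
    p_n = (X - a) r, then 0 = L (p_n r) = L ((X - a) r^2) contradicts this
    positivity ([orthogonal_nonroot]). *)

(** * Orthogonality with respect to a linear functional *)

(** Orthogonality is stated for a functional rather than for a measure, so
    that the three families can be handled through one and the same L. *)
Definition orthogonal_family (R : realFieldType) (L : {poly R} -> R)
    (p : nat -> {poly R}) : Prop :=
  [/\ forall n, p n \is monic,
      forall n, size (p n) = n.+1
    & forall m n, m <> n -> L (p m * p n) = 0].

Lemma size_polyB_lead (R : nzRingType) n (f g : {poly R}) :
  (size f <= n.+1)%N -> (size g <= n.+1)%N -> f`_n = g`_n ->
  (size (f - g)%R <= n)%N.
Proof.
move=> szf szg fg; apply/leq_sizeP => j; rewrite leq_eqVlt => /predU1P[<-|nj].
  by rewrite coefB fg subrr.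
by rewrite coefB !nth_default ?subrr// (leq_trans _ nj).
Qed.

Lemma poly_triangular_basis (F : fieldType) (p : nat -> {poly F}) :
  (forall n, size (p n) = n.+1) ->
  forall n (r : {poly F}), (size r <= n)%N ->
    exists c : nat -> F, r = \sum_(i < n) c i *: p i.
Proof.
move=> szp; elim=> [|n IHn] r szr.
  exists (fun=> 0); rewrite big_ord0; apply/eqP.
  by rewrite -size_poly_eq0 -leqn0.
have lp0 : (p n)`_n != 0.
  by rewrite -[X in _`_X]/(n.+1.-1) -(szp n) lead_coef_eq0 -size_poly_gt0 szp.
pose d := r`_n / (p n)`_n.
have /IHn[c cE] : (size (r - d *: p n)%R <= n)%N.
  apply: size_polyB_lead => //; last by rewrite coefZ divfK.
  by rewrite (leq_trans (size_scale_leq _ _))// szp.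
exists (fun i => if i == n then d else c i).
rewrite big_ord_recr /= eqxx -[LHS](subrK (d *: p n)) cE; congr (_ + _).
by apply: eq_bigr => i _; rewrite ltn_eqF.
Qed.

Definition scalar_of (R : realFieldType) (f : {poly R} -> R) (fZ : scalar f) :
    {scalar {poly R}} :=
  HB.pack f (GRing.isLinear.Build R {poly R} R *%R f fZ).

Lemma orthogonal_lower (R : realFieldType) (L : {scalar {poly R}}) p :
  orthogonal_family L p ->
  forall n (r : {poly R}), (size r <= n)%N -> L (p n * r) = 0.
Proof.
case=> _ szp orth n r /(poly_triangular_basis szp)[c ->].
rewrite mulr_sumr linear_sum big1// => i _.
rewrite -scalerAr linearZ /= orth ?mulr0//.
by move=> ni; have := ltn_ord i; rewrite -ni ltnn.
Qed.

(** * The quasi-orthogonal polynomial and the kernel at a *)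

Section christoffel_uvarov.
Context {R : realFieldType} {L : {scalar {poly R}}}.
Hypothesis L_gt0 : forall g, g != 0 -> 0 < L (g * g).
Variables (a : R) (p pss : nat -> {poly R}).
Hypothesis p_orth : orthogonal_family L p.
Hypothesis pss_orth :
  orthogonal_family (fun g => L (('X - a%:P) ^+ 2 * g)) pss.

Let q n := ('X - a%:P) * pss n.

(** Only the value of r at a survives: r - r(a) = (X - a) s, and
    q * ((X - a) * s) is (X - a)^2 times pss n * s, with s of degree less
    than n. *)
Lemma quasi_reproducing n (r : {poly R}) : (size r <= n.+1)%N ->
  L (q n * r) = L (q n) * r.[a].
Proof.
move=> szr.
have /factor_theorem[s E] : root (r - (r.[a])%:P) a.
  by rewrite /root hornerD hornerN hornerC subrr.
have szs : (size s <= n)%N.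
  have [->|s0] := eqVneq s 0; first by rewrite size_poly0.
  suff : (size (s * ('X - a%:P))%R <= n.+1)%N.
    by rewrite size_Mmonic ?monicXsubC// size_XsubC addn2.
  rewrite -E (leq_trans (size_polyD _ _))// size_polyN geq_max szr.
  by rewrite (leq_trans (size_polyC_leq1 _)).
have w_lin : scalar (fun g => L (('X - a%:P) ^+ 2 * g)).
  by move=> k u v; rewrite mulrDr -scalerAr linearD linearZ.
pose w := scalar_of w_lin.
have Ls0 : L (q n * (s * ('X - a%:P))) = 0.
  have := @orthogonal_lower _ w _ pss_orth n s szs.
  by rewrite /w /= => <-; congr (L _); rewrite /q; ring.
rewrite -[X in q n * X](subrK (r.[a])%:P) E mulrDr linearD /= Ls0 add0r.
by rewrite [q n * _]mulrC mul_polyC linearZ /= mulrC.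
Qed.

Let K n := \sum_(j < n.+1) (p j).[a] * (p j).[a] / L (p j * p j).

Let p_neq0 n : p n != 0.
Proof. by case: p_orth => _ szp _; rewrite -size_poly_gt0 szp. Qed.

Let size_q n : size (q n) = n.+2.
Proof.
case: pss_orth => _ szp _.
rewrite /q mulrC size_Mmonic ?monicXsubC// ?size_XsubC ?szp ?addn2//.
by rewrite -size_poly_gt0 szp.
Qed.

Let q_lead n : (q n)`_n.+1 = 1.
Proof.
have qm : q n \is monic by case: pss_orth => m _ _; rewrite monicMl ?monicXsubC.
by have /monicP := qm; rewrite lead_coefE size_q.
Qed.

Let p_lead n : (p n)`_n = 1.
Proof.
by case: p_orth => m szp _; have /monicP := m n; rewrite lead_coefE szp.
Qed.

(** Both polynomials are monic, so the difference lies in the span of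
    p 0, ..., p n. Its coefficients are found by testing against p j, which
    kills p n.+1 and evaluates at a on the side of q n. *)
Lemma quasi_sub_orthogonal n : q n - p n.+1 =
  L (q n) *: \sum_(j < n.+1) ((p j).[a] / L (p j * p j)) *: p j.
Proof.
have [_ szp orth] := p_orth.
have /(poly_triangular_basis szp)[c cE] : (size (q n - p n.+1)%R <= n.+1)%N.
  by apply: size_polyB_lead; rewrite ?size_q ?szp// q_lead p_lead.
rewrite cE scaler_sumr; apply: eq_bigr => j _; rewrite scalerA; congr (_ *: _).
have Lj0 : L (p j * p j) != 0 by rewrite gt_eqF ?L_gt0.
(* both sides times L (p j * p j) are the pairing of q n - p n.+1 with p j *)
apply: (mulIf Lj0); rewrite mulrA divfK//.
transitivity (L ((q n - p n.+1) * p j)).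
  rewrite cE mulr_suml linear_sum (bigD1 j)//= -scalerAl linearZ /=.
  rewrite big1 ?addr0// => i ij; rewrite -scalerAl linearZ /= orth ?mulr0//.
  by move/val_inj => ji; rewrite ji eqxx in ij.
rewrite mulrBl linearB /= quasi_reproducing ?szp//.
by rewrite (orthogonal_lower p_orth) ?szp// subr0.
Qed.

(** The previous expansion evaluated at a, where q n vanishes. *)
Lemma orthogonal_eval n : - (p n.+1).[a] = L (q n) * K n.
Proof.
have /(congr1 (horner^~ a)) := quasi_sub_orthogonal n.
rewrite /= hornerD hornerN /q hornerM hornerXsubC subrr mul0r add0r => ->.
rewrite hornerZ horner_sum; congr (_ * _); apply: eq_bigr => j _.
by rewrite hornerZ mulrAC.
Qed.

Lemma kernel_gt0 n : 0 < K n.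
Proof.
have t_ge0 j : 0 <= (p j).[a] * (p j).[a] / L (p j * p j).
  by apply: divr_ge0; [rewrite -expr2 sqr_ge0|exact/ltW/L_gt0].
rewrite /K big_ord_recl /=; apply: ltr_pwDl; last first.
  by apply: sumr_ge0 => j _; exact: t_ge0.
rewrite divr_gt0 ?L_gt0//.
have /size_poly1P[c c0 ->] : size (p 0%N) == 1%N by case: p_orth => _ ->.
by rewrite hornerC -expr2 exprn_even_gt0.
Qed.

(** N * B is the coefficient for which the contribution of q n cancels the
    point mass: B * L (q n) = - p_(n+1)(a). *)
Theorem uvarov_representation (N : R) (pN : nat -> {poly R}) n :
  0 <= N -> (p n.+1).[a] != 0 ->
  orthogonal_family (fun g => L g + N * g.[a]) pN ->
  let B := - (p n.+1).[a] / L (q n) in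
  [/\ B = K n, 0 < B & (1 + N * B) *: pN n.+1 = p n.+1 + (N * B) *: q n].
Proof.
move=> N0 pa0 pN_orth B.
have Lq0 : L (q n) != 0.
  by apply: contraNneq pa0 => Lq; rewrite -oppr_eq0 orthogonal_eval Lq mul0r.
have BE : B = K n by rewrite /B orthogonal_eval mulrAC divff ?mul1r.
have B0 : 0 < B by rewrite BE kernel_gt0.
split => //; apply/eqP; rewrite eq_sym -subr_eq0; set f := p _ + _.
have [_ szp _] := p_orth; have [mN szN _] := pN_orth.
have pN_lead : (pN n.+1)`_n.+1 = 1.
  by have /monicP := mN n.+1; rewrite lead_coefE szN.
set g := f - _.
have szg : (size g <= n.+1)%N.
  apply: size_polyB_lead.
  - rewrite (leq_trans (size_polyD _ _))// geq_max szp leqnn.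
    by rewrite (leq_trans (size_scale_leq _ _))// size_q.
  - by rewrite (leq_trans (size_scale_leq _ _))// szN.
  - by rewrite coefD !coefZ p_lead q_lead pN_lead; ring.
have LN_lin : scalar (fun g => L g + N * g.[a]).
  by move=> k u v; rewrite linearP hornerD hornerZ /=; ring.
pose LN := scalar_of LN_lin.
have LNE u : LN u = L u + N * u.[a] by [].
have LNf : LN (f * g) = 0.
  rewrite LNE /f hornerM mulrDl -scalerAl linearD linearZ /=.
  rewrite (orthogonal_lower p_orth)// quasi_reproducing// (hornerD (p _)) hornerZ.
  rewrite /q hornerM hornerXsubC subrr mul0r mulr0 addr0 add0r.
  by rewrite mulrA -(mulrA N B) divfK//; ring.
have LNpN : LN (pN n.+1 * g) = 0 by exact: (@orthogonal_lower _ LN).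
have : LN (g * g) = 0.
  by rewrite {1}/g mulrBl linearB LNf -scalerAl linearZ_LR LNpN [_ * 0]mulr0 subr0.
have [//|g0] := eqVneq g 0.
move/eqP; rewrite LNE hornerM -expr2 gt_eqF//.
by rewrite ltr_wpDr ?L_gt0// mulr_ge0// sqr_ge0.
Qed.

End christoffel_uvarov.

(** * Integration against a measure with a density *)

Section density.
Local Open Scope ereal_scope.
Context d (T : measurableType d) (R : realType).
Variables (mu nu : {measure set T -> \bar R}) (g : T -> R).
Hypothesis g_ge0 : forall x, (0 <= g x)%R.
Hypothesis mg : measurable_fun setT g.
Hypothesis nuE : forall A, measurable A -> nu A = \int[mu]_(x in A) (g x)%:E.
Variable D : set T.
Hypothesis mD : measurable D.

Let mgD : measurable_fun D (EFin \o g).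
Proof. exact/measurable_EFinP/measurable_funTS. Qed.

Import HBNNSimple.

Lemma integral_density_nnsfun (h : {nnsfun T >-> R}) :
  \int[nu]_(x in D) (h x)%:E = \int[mu]_(x in D) ((h x)%:E * (g x)%:E).
Proof.
have mind r : measurable_fun D (fun x => (r * \1_(h @^-1` [set r]) x)%:E).
  by apply/measurable_EFinP/measurable_funTS; exact: measurable_funM.
under eq_integral do rewrite fimfunE -fsumEFin//.
rewrite ge0_integral_fsum//; last by move=> r x _; exact: nnfun_muleindic_ge0.
under [RHS]eq_integral => x _.
  rewrite fimfunE -fsumEFin// ge0_mule_fsuml; last first.
    by move=> r; exact: nnfun_muleindic_ge0.
  over.
rewrite [RHS]ge0_integral_fsum//; last 2 first.
- by move=> r; apply: emeasurable_funM.
- by move=> r x _; rewrite mule_ge0 ?nnfun_muleindic_ge0 ?lee_fin.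
apply: eq_fsbigr => r; rewrite inE => -[t _ <-].
rewrite integralZl_indic_nnsfun// integral_indic//.
under [RHS]eq_integral do rewrite EFinM -muleA.
rewrite ge0_integralZl//; last 3 first.
- by apply: emeasurable_funM => //; exact/measurable_EFinP/measurable_funTS.
- by move=> x _; rewrite mule_ge0 ?lee_fin.
- by rewrite lee_fin.
congr (_ * _); rewrite nuE; last exact: measurableI.
rewrite setIC integral_mkcondr; apply: eq_integral => x _.
by rewrite epatch_indic muleC.
Qed.

Lemma ge0_integral_density (f : T -> \bar R) :
  measurable_fun D f -> (forall x, D x -> 0 <= f x) ->
  \int[nu]_(x in D) f x = \int[mu]_(x in D) (f x * (g x)%:E).
Proof.
move=> mf f0; pose h := nnsfun_approx mD mf.
have hf x : D x -> (h n x)%:E @[n --> \oo] --> f x.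
  by move=> Dx; exact: (cvg_nnsfun_approx mD mf f0 Dx).
have mh n : measurable_fun D (EFin \o h n).
  exact/measurable_EFinP/measurable_funTS.
have nd_h x m n : (m <= n)%N -> (h m x)%:E <= (h n x)%:E.
  by move=> mn; rewrite lee_fin; exact/lefP/nd_nnsfun_approx.
transitivity (limn (fun n => \int[nu]_(x in D) (h n x)%:E)).
  rewrite -monotone_convergence//.
  - by apply: eq_integral => x /set_mem Dx; apply/esym/cvg_lim => //; exact: hf.
  - by move=> n x _; rewrite lee_fin.
  - by move=> x _ m n; exact: nd_h.
under eq_fun do rewrite integral_density_nnsfun.
rewrite -monotone_convergence//.
- apply: eq_integral => x /set_mem Dx; apply/cvg_lim => //.
  by apply: cvgeZr => //; exact: hf.
- by move=> n; apply: emeasurable_funM; [exact: mh|exact: mgD].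
- by move=> n x _; rewrite mule_ge0 ?lee_fin.
- by move=> x _ m n mn; rewrite lee_wpmul2r ?lee_fin// -lee_fin nd_h.
Qed.

(** As g is nonnegative, it commutes with taking positive and negative parts,
    and the identity holds for each part, convergent or not. *)
Lemma integral_density (f : T -> R) : measurable_fun D f ->
  \int[nu]_(x in D) (f x)%:E = \int[mu]_(x in D) (f x * g x)%:E.
Proof.
move=> mf; have mfE : measurable_fun D (EFin \o f) by exact/measurable_EFinP.
rewrite integralE [RHS]integralE.
rewrite !ge0_integral_density//; try exact: measurable_funepos;
  try exact: measurable_funeneg.
congr (_ - _); apply: eq_integral => x _.
- by rewrite !funeposE /= -!EFin_max -EFinM maxr_pMl// mul0r.
- by rewrite !funenegE /= -!EFin_max -EFinM maxr_pMl// mul0r mulNr.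
Qed.

End density.

(** * The support of a measure on the line *)

Section support.
Context {R : realType}.
Variable mu : {measure set (measurableTypeR R) -> \bar R}.

Let supp : set R := msupport mu.

Lemma notin_msupport x :
  ~ supp x -> exists U : set R, [/\ open U, U x & mu U = 0%E].
Proof.
move=> /existsNP[U /not_implyP[oU /not_implyP[Ux mU]]]; exists U; split => //.
by apply/eqP; rewrite -measure_le0 leNgt; exact/negP.
Qed.

Lemma closed_msupport : closed supp.
Proof.
rewrite -[supp]setCK; apply: open_closedC; rewrite openE => x /notin_msupport.
move=> [U [oU Ux U0]]; apply: (filterS _ (open_nbhs_nbhs (conj oU Ux))).
by move=> y Uy /(_ U oU Uy); rewrite U0 ltxx.
Qed.

Lemma measurable_msupport : measurable (supp : set (measurableTypeR R)).
Proof. by apply: closed_measurable; exact: closed_msupport. Qed.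

(** Every point outside the support has a null neighbourhood, and this can be
    taken to be an interval with rational endpoints; there are countably many
    of those. *)
Lemma msupportC_null : mu (~` supp) = 0%E.
Proof.
have mC : measurable (~` supp : set (measurableTypeR R)).
  by apply: measurableC; exact: measurable_msupport.
(* F lists the null rational intervals through the coding of pairs by nat *)
pose J (u : rat * rat) : set R := `]ratr u.1, ratr u.2[%classic.
pose F k : set R :=
  if unpickle k is Some u then if mu (J u) == 0%E then J u else set0 else set0.
have nF k : mu.-negligible (F k).
  rewrite /F; case: unpickle => [u|]; last exact: negligible_set0.
  case: ifPn => [/eqP mu0|_]; last exact: negligible_set0.
  by apply/negligibleP => //; exact: measurable_itv.
apply/negligibleP => //; apply: negligibleS (negligible_bigcup nF).
move=> x /notin_msupport[U [oU Ux U0]].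
have [e /= e0 xeU] : nbhs_ball x U by apply/nbhs_ballP; exact: open_nbhs_nbhs.
have /rat_in_itvoo[q1] : x - e < x by rewrite ltrBlDr ltrDl.
have /rat_in_itvoo[q2] : x < x + e by rewrite ltrDl.
rewrite !in_itv /= => /andP[xq2 q2e] /andP[eq1 q1x].
(* the index is given explicitly so that pickle is never unfolded *)
refine (ex_intro2 _ _ (pickle (q1, q2)) I _); rewrite /F pickleK.
have IU : J (q1, q2) `<=` U.
  move=> y; rewrite /J /= in_itv /= => /andP[q1y yq2]; apply: xeU.
  by rewrite /ball /= ltr_norml; apply/andP; split; lra.
have -> : mu (J (q1, q2)) == 0%E.
  rewrite -measure_le0 -U0 le_measure ?inE//; first exact: measurable_itv.
  exact: open_measurable.
by rewrite /J /= in_itv /= q1x xq2.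
Qed.

(** The supports of the modified measures may differ from that of mu; this
    brings integrals against mu over any of them back to the support of mu. *)
Lemma integral_msupport (D : set R) (f : R -> R) :
    measurable (D : set (measurableTypeR R)) -> supp `<=` D ->
    measurable_fun setT f ->
  (\int[mu]_(x in D) (f x)%:E = \int[mu]_(x in supp) (f x)%:E)%E.
Proof.
move=> mD sD mf; have ms := measurable_msupport.
rewrite -[in RHS](setIidr sD) integral_mkcondr.
have mfE A : measurable_fun A (EFin \o f : measurableTypeR R -> _).
  exact/measurable_EFinP/measurable_funTS.
apply: ae_eq_integral => //.
  by apply/measurable_restrict => //; exact: mfE.
exists (~` supp); split; [exact: measurableC|exact: msupportC_null|].
move=> x /= /not_implyP[_ fx] sx; apply: fx.
by rewrite patchE mem_set.
Qed.

(** Near a point of the support where f is positive, f stays above f x / 2 on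
    an open set, which has positive measure; Markov's inequality concludes.
    The set O allows D to be the support itself as well as an open set. *)
Lemma integral_gt0 (O D : set R) (f : R -> R) x :
    measurable (D : set (measurableTypeR R)) -> open O -> O `&` supp `<=` D ->
    continuous f -> (forall y, D y -> 0 <= f y) ->
    O x -> supp x -> 0 < f x ->
  (0 < \int[mu]_(y in D) (f y)%:E)%E.
Proof.
move=> mD oO OD cf f0 Ox sx fx0.
have mf : measurable_fun D (EFin \o f : measurableTypeR R -> _).
  apply/measurable_EFinP/measurable_funTS.
  exact: continuous_measurable_fun.
pose c := f x / 2; have c0 : 0 < c by rewrite divr_gt0.
pose V := O `&` f @^-1` [set y | c < y].
have oV : open V by apply: openI => //; apply: open_comp => // y _; exact: cf.
have mV : measurable (V : set (measurableTypeR R)) by exact: open_measurable.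
have Vx : V x by split => //; rewrite /preimage /= /c; lra.
have V0 : (0 < mu V)%E by exact: (sx V oV Vx).
have ms := measurable_msupport.
have Vs : mu (V `&` supp) = mu V.
  apply: etrans (esym (add0e _)) (esym _).
  apply: etrans (measureDI mu mV ms) (congr1 (fun z => z + _)%E _).
  apply: subset_measure0 msupportC_null; last by move=> y [].
  - exact: measurableD.
  - exact: measurableC.
have -> : (\int[mu]_(y in D) (f y)%:E = \int[mu]_(y in D) `|(f y)%:E|)%E.
  by apply: eq_integral => y /set_mem Dy; rewrite gee0_abs// lee_fin f0.
apply: lt_le_trans (le_integral_abse mu mD mf c0).
rewrite mule_gt0 ?lte_fin// (lt_le_trans V0)// -Vs le_measure ?inE//.
- exact: measurableI.
- by apply: emeasurable_fun_c_infty => //; exact: measurableT_comp.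
- move=> y [[Oy /= cy] sy]; split; first exact: OD.
  by rewrite /= lee_fin (le_trans (ltW cy))// ler_norm.
Qed.
End support.

(** * The moment functional *)

Lemma infinite_not_roots (R : realFieldType) (A : set R) (g : {poly R}) :
  infinite_set A -> g != 0 -> exists2 x, A x & ~~ root g x.
Proof.
move=> Ainf g0; apply: contrapT => /forall2NP Aroot.
have [B BA szB] := infinite_set_fset (size g) Ainf.
have rB : all (root g) (finmap.enum_fset B).
  apply/allP => x xB; have [/(_ (BA x xB))|/negP] := Aroot x => //.
  by rewrite negbK.
by have := max_poly_roots g0 rB (finmap.fset_uniq B); rewrite ltnNge szB.
Qed.

Section moment_functional.
Context {R : realType}.
Variable mu : {measure set (measurableTypeR R) -> \bar R}.
Hypothesis mu_moments : finite_moments mu.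

Let supp : set R := msupport mu.

Definition moment_functional (g : {poly R}) : R :=
  Rintegral mu (msupport mu) (fun x => g.[x]).

Lemma inner_moment_functional p q : inner mu p q = moment_functional (p * q).
Proof.
by rewrite /moment_functional; under eq_Rintegral do rewrite hornerM.
Qed.

Lemma measurable_fun_horner (D : set R) (g : {poly R}) :
  measurable_fun (D : set (measurableTypeR R)) (fun x => (g.[x])%:E).
Proof.
apply/measurable_EFinP/measurable_funTS.
by apply: continuous_measurable_fun; exact: continuous_horner.
Qed.

Lemma integrable_horner (g : {poly R}) :
  mu.-integrable supp (fun x => (g.[x])%:E).
Proof.
have ms := measurable_msupport mu.
have intX n : mu.-integrable supp (fun x => (x ^+ n)%:E).
  apply/integrableP; split.
    by under eq_fun do rewrite -hornerXn; exact: measurable_fun_horner.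
  by under eq_integral do rewrite /= normrX; exact: mu_moments.
under eq_fun do rewrite horner_coef -sumEFin.
apply: integrable_sum => // i _.
by under eq_fun do rewrite EFinM; exact: integrableZl.
Qed.

Lemma moment_functional_scalar : scalar moment_functional.
Proof.
have ms := measurable_msupport mu.
move=> k u v; rewrite /moment_functional.
rewrite -RintegralZl//; last exact: integrable_horner.
rewrite -RintegralD//; [|under eq_fun do rewrite -hornerZ|];
  try exact: integrable_horner.
by apply: eq_Rintegral => x _; rewrite hornerD hornerZ.
Qed.

Lemma moment_functional_fin (g : {poly R}) :
  (\int[mu]_(x in supp) (g.[x])%:E = (moment_functional g)%:E)%E.
Proof.
rewrite /moment_functional /Rintegral fineK//.
apply: integrable_fin_num; first exact: measurable_msupport.
exact: integrable_horner.
Qed.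

Hypothesis supp_inf : infinite_set supp.

Lemma moment_functional_gt0 (g : {poly R}) :
  g != 0 -> (forall x, supp x -> 0 <= g.[x]) -> 0 < moment_functional g.
Proof.
move=> g0 gge0; have [x sx gx] := infinite_not_roots supp_inf g0.
rewrite -lte_fin -moment_functional_fin.
apply: (@integral_gt0 _ mu setT supp (horner g) x) => //.
- exact: measurable_msupport.
- exact: openT.
- exact: continuous_horner.
- by rewrite lt_neqAle gge0// eq_sym gx.
Qed.

End moment_functional.

(** * The measures with a quadratic weight and with a point mass *)

Section modified_measures.
Context {R : realType}.
Variable mu : {measure set (measurableTypeR R) -> \bar R}.
Hypothesis mu_moments : finite_moments mu.
Variable a : R.

(** A point of the support differs from a, so the weight is positive there. *)
Lemma msupport_sqr_weight : ~ msupport mu a ->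
  msupport mu `<=` msupport (sqr_weight mu a).
Proof.
move=> a_out x sx U oU Ux.
have xa : x != a by apply/eqP => xa; rewrite xa in sx.
have hE (y : R) : (('X - a%:P) ^+ 2).[y] = (y - a) ^+ 2 by rewrite !hornerE.
apply: (@integral_gt0 _ mu U U (fun y => (y - a) ^+ 2) x) => //.
- exact: open_measurable.
- under eq_fun do rewrite -hE; exact: continuous_horner.
- by move=> y _; exact: sqr_ge0.
- by rewrite exprn_even_gt0//= subr_eq0.
Qed.

Lemma inner_sqr_weight p q : ~ msupport mu a ->
  inner (sqr_weight mu a) p q =
  moment_functional mu (('X - a%:P) ^+ 2 * (p * q)).
Proof.
move=> a_out; rewrite inner_moment_functional /moment_functional /Rintegral.
have hE (y : R) : (('X - a%:P) ^+ 2).[y] = (y - a) ^+ 2 by rewrite !hornerE.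
have mD := measurable_msupport (sqr_weight mu a).
congr fine; rewrite (@integral_density _ _ _ mu _ (fun x => (x - a) ^+ 2))//.
- under eq_integral do rewrite -hE -hornerM mulrC.
  rewrite integral_msupport//; first exact: msupport_sqr_weight.
  by apply: continuous_measurable_fun; exact: continuous_horner.
- by move=> x; exact: sqr_ge0.
- under eq_fun do rewrite -hE.
  by apply: continuous_measurable_fun; exact: continuous_horner.
- apply: measurable_funTS.
  by apply: continuous_measurable_fun; exact: continuous_horner.
Qed.

Lemma integral_mscale_dirac (N : {nonneg R}) (D : set R) (f : R -> R) :
    measurable (D : set (measurableTypeR R)) ->
    measurable_fun (setT : set (measurableTypeR R)) f ->
  (\int[mscale N (@dirac _ (measurableTypeR R) a R)]_(x in D) (f x)%:E =
   (N%:num * (a \in D)%:R * f a)%:E)%E.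
Proof.
move=> mD mf.
have mfE : measurable_fun (D : set (measurableTypeR R)) (EFin \o f).
  exact/measurable_EFinP/measurable_funTS.
have mfp := measurable_funepos mfE; have mfn := measurable_funeneg mfE.
rewrite integralE !ge0_integral_mscale// !integral_dirac//.
have fin (h : measurableTypeR R -> \bar R) :
    h a \is a fin_num -> (\d_a D * h a)%E \is a fin_num.
  by move=> ha; rewrite fin_numM// diracE.
have finp : (EFin \o f)^\+%E a \is a fin_num.
  by rewrite funeposE /= -EFin_max.
have finn : (EFin \o f)^\-%E a \is a fin_num.
  by rewrite funenegE /= -EFin_max.
rewrite -muleBr//; last by rewrite fin_num_adde_defl// fin_numN fin.
rewrite -muleBr//; last by rewrite fin_num_adde_defl// fin_numN.
rewrite -mulrA EFinM; congr (_ * _)%E; rewrite EFinM diracE; congr (_ * _)%E.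
by rewrite -[(f a)%:E]/((EFin \o f) a) [in RHS](funeposneg (EFin \o f)).
Qed.

Lemma add_massE (N : {nonneg R}) (U : set R) :
  (add_mass mu N a U = mu U + (N%:num * (a \in U)%:R)%:E)%E.
Proof.
apply: etrans (measure_addE _ _ _) (congr1 (fun z => mu U + z)%E _).
rewrite EFinM.
have e : (@dirac _ (measurableTypeR R) a R U = (a \in U)%:R%:E)%E.
  exact: diracE.
by rewrite -e.
Qed.

(** The integral runs over the support of the modified measure. That set
    contains the support of mu, and it contains a as soon as N is nonzero, so
    the point mass is counted in full. *)
Lemma inner_add_mass (N : {nonneg R}) p q :
  inner (add_mass mu N a) p q =
  moment_functional mu (p * q) + N%:num * (p * q).[a].
Proof.
rewrite inner_moment_functional /moment_functional /Rintegral.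
set D : set R := msupport (add_mass mu N a); set g := p * q.
have mD : measurable (D : set (measurableTypeR R)).
  exact: measurable_msupport.
have mg : measurable_fun (setT : set (measurableTypeR R)) (horner g).
  by apply: continuous_measurable_fun; exact: continuous_horner.
have mabs : measurable_fun (setT : set (measurableTypeR R))
    (fun x => `|g.[x]|) by exact: measurableT_comp.
have sD : msupport mu `<=` D.
  move=> x sx U oU Ux; rewrite add_massE.
  by rewrite (lt_le_trans (sx U oU Ux))// leeDl// lee_fin mulr_ge0.
have intD : mu.-integrable D (fun x => (g.[x])%:E).
  apply/integrableP; split; first exact: measurable_fun_horner.
  have /integrableP[_] := integrable_horner mu_moments g.
  by apply: le_lt_trans; rewrite (integral_msupport mD sD mabs).
have NaD : N%:num * (a \in D)%:R = N%:num.
  have [->|N0] := eqVneq N%:num 0; first by rewrite mul0r.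
  rewrite mem_set ?mulr1// => U oU Ua; rewrite add_massE mem_set// mulr1.
  by rewrite (@lt_le_trans _ _ N%:num%:E) ?leeDr// lte_fin lt_neqAle eq_sym N0/=.
have intd : (mscale N (@dirac _ (measurableTypeR R) a R)).-integrable D
    (fun x => (g.[x])%:E).
  apply/integrableP; split; first exact: measurable_fun_horner.
  by rewrite (integral_mscale_dirac _ mD mabs) ltry.
have := integral_measure_add mD intD intd.
move=> /(congr1 fine) -> /=.
rewrite integral_msupport// integral_mscale_dirac// NaD.
by rewrite moment_functional_fin.
Qed.

End modified_measures.

(** * Position of a and conclusion *)

(** If x <= a <= y with x and y in A, then a is a convex combination of x and
    y. *)
Lemma notin_convex_hull (R : realType) (A : set R) a : ~ convex_hull A a ->
  (forall x, A x -> a < x) \/ (forall x, A x -> x < a).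
Proof.
move=> aA.
have Aa x y : A x -> A y -> x <= a -> a <= y -> False.
  move=> Ax Ay xa ay; apply: aA => C [/= cC AC].
  have [xy|xy] := eqVneq x y.
    by have -> : a = x; [apply/eqP; rewrite eq_le xa xy ay|exact: AC].
  (* a = t x + (1 - t) y for this t *)
  have t01 : 0 <= (y - a) / (y - x) <= 1.
    have yx : 0 < y - x by rewrite subr_gt0 lt_neqAle xy (le_trans xa).
    by rewrite ler_pdivlMr// mul0r subr_ge0 ay ler_pdivrMr// mul1r lerB.
  have := cC x y (Itv01 (andP t01).1 (andP t01).2)
    (mem_set (AC _ Ax)) (mem_set (AC _ Ay)).
  rewrite inE; congr C; apply: etrans (convRE _ _ _) _; rewrite /= /unstable.onem.
  by field; rewrite subr_eq0 eq_sym.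
have [[x Ax xa]|noA] := pselect (exists2 x, A x & x <= a); last first.
  by left=> x Ax; rewrite ltNge; apply/negP => xa; apply: noA; exists x.
right=> y Ay; rewrite ltNge; apply/negP => ay; exact: (Aa x y).
Qed.

(** A root a of p n.+1 would give p n.+1 = r * (X - a) with r orthogonal to
    p n.+1, although (X - a) * r^2 has a constant sign on the support. *)
Lemma orthogonal_nonroot (R : realType)
    (mu : {measure set (measurableTypeR R) -> \bar R}) (a : R) p n :
  infinite_set (msupport mu) -> finite_moments mu ->
  ~ convex_hull (msupport mu) a ->
  orthogonal_family (moment_functional mu) p -> (p n.+1).[a] != 0.
Proof.
move=> supp_inf mu_moments a_out p_orth; apply/negP => /factor_theorem[r prE].
have [_ szp _] := p_orth.
have r0 : r != 0.
  apply/eqP => r0; have := szp n.+1.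
  by rewrite prE r0 mul0r size_poly0.
have szr : (size r <= n.+1)%N.
  have := szp n.+1.
  by rewrite prE size_Mmonic ?monicXsubC// size_XsubC addn2 => -[->].
pose L := scalar_of (moment_functional_scalar mu_moments).
have LE g : L g = moment_functional mu g by [].
have Lr0 : L (('X - a%:P) * (r * r)) = 0.
  have := @orthogonal_lower _ L _ p_orth n.+1 r szr.
  by rewrite prE => <-; congr (L _); ring.
have g0 : ('X - a%:P) * (r * r) != 0 by rewrite !mulf_neq0 ?polyXsubC_eq0.
have hE x : (('X - a%:P) * (r * r)).[x] = (x - a) * r.[x] ^+ 2.
  by rewrite !hornerM hornerXsubC -expr2.
have [lo|hi] := notin_convex_hull a_out.
- have := moment_functional_gt0 mu_moments supp_inf g0.
  rewrite -LE Lr0 ltxx => /(_ _)/notF; apply=> x /lo ax.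
  by rewrite hE mulr_ge0 ?sqr_ge0// subr_ge0 ltW.
- have := moment_functional_gt0 mu_moments supp_inf _ (g := - (('X - a%:P) * (r * r))).
  rewrite oppr_eq0 -LE linearN Lr0 oppr0 ltxx => /(_ g0 _)/notF; apply=> x /hi xa.
  by rewrite hornerN hE -mulNr mulr_ge0 ?sqr_ge0// oppr_ge0 subr_le0 ltW.
Qed.

Theorem theorem2 (R : realType)
    (mu : {measure set (measurableTypeR R) -> \bar R})
    (supp_inf : infinite_set (msupport mu))
    (moments : finite_moments mu)
    (N : {nonneg R}) (a : R)
    (a_out : ~ convex_hull (msupport mu) a)
    (p pss pN : nat -> {poly R})
    (p_orth : monic_orthogonal mu p)
    (pss_orth : monic_orthogonal (sqr_weight mu a) pss)
    (pN_orth : monic_orthogonal (add_mass mu N a) pN) :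
  let B n := - (p n).[a] / inner mu ('X - a%:P) (pss n.-1) in
  let k n := 1 + N%:num * B n in
  let phat n := k n *: pN n in
  forall n : nat, (1 <= n)%N ->
    [/\ B n = kernel_poly mu p n.-1 a a,
        0 < B n
      & phat n = p n + (N%:num * B n) *: (('X - a%:P) * pss n.-1)].
Proof.
move=> B k phat [//|n] _.
have a_supp : ~ msupport mu a.
  by move=> sa; apply: a_out; exact: sub_gen_smallest.
pose L := scalar_of (moment_functional_scalar moments).
have LE g : L g = moment_functional mu g by [].
have L_gt0 g : g != 0 -> 0 < L (g * g).
  move=> g0; rewrite LE moment_functional_gt0 ?mulf_neq0// => x _.
  by rewrite hornerM -expr2 sqr_ge0.
have p_orthL : orthogonal_family L p.
  case: p_orth => pm szp orth; split=> // i j ij.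
  by rewrite LE -inner_moment_functional orth.
have pss_orthL : orthogonal_family (fun g => L (('X - a%:P) ^+ 2 * g)) pss.
  case: pss_orth => pm szp orth; split=> // i j ij.
  by rewrite LE -inner_sqr_weight// orth.
have pN_orthL : orthogonal_family (fun g => L g + N%:num * g.[a]) pN.
  case: pN_orth => pm szp orth; split=> // i j ij.
  by rewrite LE -inner_add_mass// orth.
have pa0 : (p n.+1).[a] != 0.
  exact: (orthogonal_nonroot n supp_inf moments a_out p_orthL).
have [] := uvarov_representation L_gt0 p_orthL pss_orthL _ pa0 pN_orthL => //.
have -> : - (p n.+1).[a] / L (('X - a%:P) * pss n) = B n.+1.
  by rewrite /B LE inner_moment_functional.
move=> BE B0 pNE; split => //.
rewrite BE /kernel_poly big_mkord; apply: eq_bigr => j _.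
by rewrite LE inner_moment_functional.
Qed.
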